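(* Let $D$ be a bounded distributive lattice. The maps $\gamma^{\#}\colon\mathcal{M}_{\Gamma}(D)^{\downarrow}\to\mathcal{M}_{I}(D)^{\downarrow}$, $\mu\mapsto\gamma\circ\mu$, and $\iota^{\#}\colon\mathcal{M}_{I}(D)^{\downarrow}\to\mathcal{M}_{\Gamma}(D)^{\downarrow}$, $m\mapsto\iota\circ m$, are a retraction-section pair of topological spaces; that is, both are continuous and $\gamma^{\#}\circ\iota^{\#}$ is the identity.
   Context: The Priestley space $\mathbf{\Gamma}$. Its underlying set consists of formal symbols $\{r^{-}\mid r\in(0,1]\}\cup\{q^{\circ}\mid q\in[0,1]\cap\mathbb{Q}\}$, totally ordered by: $r^{-}<s^{-}$ iff $r<s$; $p^{\circ}<q^{\circ}$ iff $p<q$; $r^{-}<q^{\circ}$ iff $r\le q$; $q^{\circ}<r^{-}$ iff $q<r$. Its topology is generated by the sets $\{x\mid p^{\circ}\le x\}$ for $p\in\mathbb{Q}\cap[0,1]$ and $\{x\mid x\le q^{-}\}$ for $q\in\mathbb{Q}\cap(0,1]$. Two partial operations on $\mathbf{\Gamma}$, $x-y$ and $x\sim y$, are defined exactly when $y\le x$. The first is: $r^{\circ}-s^{\circ}=(r-s)^{\circ}$; $r^{-}-s^{\circ}=(r-s)^{-}$; and both $r^{\circ}-s^{-}$ and $r^{-}-s^{-}$ equal $(r-s)^{\circ}$ if $r-s\in\mathbb{Q}$ and $(r-s)^{-}$ otherwise. The second is $x\sim y=\bigvee\{x-q^{\circ}\mid q\in\mathbb{Q}\cap[0,1],\ y<q^{\circ}\le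 x\}$ (so $x\sim x=0^{\circ}$, the bottom element). Lattices are bounded with bounds $0,1$. A $\mathbf{\Gamma}$-valued measure on a bounded distributive lattice $D$ is a function $\mu\colon D\to\mathbf{\Gamma}$ such that (1) $\mu$ is monotone; (2) $\mu(0)=0^{\circ}$ and $\mu(1)=1^{\circ}$; (3) for all $a,b\in D$, $\mu(a)\sim\mu(a\wedge b)\le\mu(a\vee b)-\mu(b)$ and $\mu(a)-\mu(a\wedge b)\ge\mu(a\vee b)\sim\mu(b)$. The set $\mathcal{M}_{\Gamma}(D)$ of all such measures carries the order and topology induced by the product order and product topology of $\mathbf{\Gamma}^{D}$. $\mathcal{M}_{I}(D)$ is the set of monotone functions $m\colon D\to[0,1]$ with $m(0)=0$, $m(1)=1$ and $m(a)+m(b)=m(a\vee b)+m(a\wedge b)$ for all $a,b\in D$, with order and topology induced by the product order and product topology of $[0,1]^{D}$. The map $\gamma\colon\mathbf{\Gamma}\to[0,1]$ sends $r^{-}$ and $r^{\circ}$ to $r$. The map $\iota\colon[0,1]\to\mathbf{\Gamma}$ sends $r$ to $r^{\circ}$ if $r\in\mathbb{Q}$ and to $r^{-}$ otherwise. Composition with $\gamma$ (resp. $\iota$) sends measures in $\mathcal{M}_{\Gamma}(D)$ to $\mathcal{M}_{I}(D)$ (resp. $\mathcal{M}_{I}(D)$ to $\mathcal{M}_{\Gamma}(D)$). For a partially ordered topological space $X$, $X^{\downarrow}$ denotes the space with the same underlying set whose open sets are the open down-sets of $X$. *)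

(* Defs.v *)
From HB Require Import structures.
From mathcomp Require Import all_boot all_order all_algebra.
From mathcomp Require Import interval_inference.
From mathcomp Require Import all_classical all_reals topology normedtype.
From mathcomp Require Import lra.

Set Implicit Arguments.
Unset Strict Implicit.
Unset Printing Implicit Defensive.

Import Order.TTheory GRing.Theory Num.Theory.
Import numFieldNormedType.Exports.

Local Open Scope classical_set_scope.
Local Open Scope ring_scope.

(* [Minus r] is the symbol r^- and [Circ q] is the symbol q°; the range and
   rationality constraints are imposed by [gvalid] below. *)
Variant gsymbol (R : Type) := Minus of R | Circ of R.

Section Symbols.
Variable R : realType.
Implicit Types x y z : gsymbol R.

HB.instance Definition _ := gen_eqMixin (gsymbol R).
HB.instance Definition _ := gen_choiceMixin (gsymbol R).

Definition gsym_lt x y :=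
  match x, y with
  | Minus r, Minus s => r < s
  | Circ p, Circ q => p < q
  | Minus r, Circ q => r <= q
  | Circ q, Minus r => q < r
  end.

Fact gsym_lt_irr : irreflexive gsym_lt.
Proof. by case=> r /=; rewrite ltxx. Qed.

Fact gsym_lt_trans : transitive gsym_lt.
Proof. by case=> y [x|x] [z|z] /=; lra. Qed.

Fact gsymbol_display : Order.disp_t.
Proof. exact: Order.default_display. Qed.

HB.instance Definition _ := Order.Lt_isPOrder.Build gsymbol_display (gsymbol R)
  gsym_lt_irr gsym_lt_trans.

Fact gsym_le_total : total (<=%O : rel (gsymbol R)).
Proof.
move=> x y; rewrite le_eqVlt [(y <= x)%O]le_eqVlt /Order.lt /= /gsym_lt.
case: x => r; case: y => s.
- by case: (ltgtP r s) => [_|_|->]; rewrite ?orbT ?eqxx.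
- by case: (leP r s); rewrite ?orbT.
- by case: (ltP r s); rewrite ?orbT.
- by case: (ltgtP r s) => [_|_|->]; rewrite ?orbT ?eqxx.
Qed.

HB.instance Definition _ := Order.POrder_isTotal.Build gsymbol_display
  (gsymbol R) gsym_le_total.

Definition gvalid x :=
  match x with
  | Minus r => 0 < r <= 1
  | Circ q => (0 <= q <= 1) && `[< rational q >]
  end.

Definition gsym_val x := match x with Minus r => r | Circ q => q end.

Definition gsym_of (r : R) : gsymbol R :=
  if `[< rational r >] then Circ r else Minus r.

Definition gsym_sub x y : gsymbol R :=
  match x, y with
  | Circ r, Circ s => Circ (r - s)
  | Minus r, Circ s => Minus (r - s)
  | Circ r, Minus s => gsym_of (r - s)
  | Minus r, Minus s => gsym_of (r - s)
  end.

End Symbols.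

Record Gamma (R : realType) := MkGamma {
  gsym :> gsymbol R;
  gsymP : gvalid gsym }.

Section Gamma.
Variable R : realType.

HB.instance Definition _ := [isSub for @gsym R].
HB.instance Definition _ := [Choice of Gamma R by <:].
HB.instance Definition _ :=
  [SubChoice_isSubOrder of Gamma R by <: with gsymbol_display].

Fact rational0 : rational (0 : R).
Proof. by exists 0 => //; rewrite rmorph0. Qed.

Fact rational1 : rational (1 : R).
Proof. by exists 1 => //; rewrite rmorph1. Qed.

Fact gbot_subproof : gvalid (Circ (0 : R)).
Proof. by rewrite /= lexx ler01; apply/asboolP/rational0. Qed.

Fact gtop_subproof : gvalid (Circ (1 : R)).
Proof. by rewrite /= lexx ler01; apply/asboolP/rational1. Qed.

Definition gbot : Gamma R := MkGamma gbot_subproof.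
Definition gtop : Gamma R := MkGamma gtop_subproof.

Definition gsubbase : set (set (Gamma R)) :=
  [set [set x : Gamma R | (Circ p <= gsym x)%O]
     | p in [set p : R | rational p /\ 0 <= p <= 1]] `|`
  [set [set x : Gamma R | (gsym x <= Minus q)%O]
     | q in [set q : R | rational q /\ 0 < q <= 1]].

HB.instance Definition _ :=
  isSubBaseTopological.Build (Gamma R) gsubbase (@id (set (Gamma R))).

(* Meaningful only when y <= x, in which case [gsym_sub x y] is a valid symbol
   (lemma [gsubE]); outside this domain the value may be the default 0°. *)
Definition gsub (x y : Gamma R) : Gamma R := insubd gbot (gsym_sub x y).

(* The set of points z = q° with y < q° <= x; the join of the empty set is 0°,
   and the join always exists when y <= x (lemma [gsim_supremums]). *)
Definition gcirc_between (y x : Gamma R) : set (Gamma R) :=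
  [set z | (exists q, gsym z = Circ q) /\ (y < z <= x)%O].

Definition gsim (x y : Gamma R) : Gamma R :=
  supremum gbot [set gsub x z | z in gcirc_between y x].

Fact gamma_ge0 (x : Gamma R) : 0 <= gsym_val x.
Proof. by case: x => -[r|r] /=; lra. Qed.

Fact gamma_le1 (x : Gamma R) : gsym_val x <= 1.
Proof. by case: x => -[r|r] /=; lra. Qed.

Definition gammaG (x : Gamma R) : {i01 R} := Itv01 (gamma_ge0 x) (gamma_le1 x).

Fact iota_subproof (r : {i01 R}) : gvalid (gsym_of r%:num).
Proof.
rewrite /gsym_of; case: ifPn => [rQ|rQ] /=; rewrite ?rQ ?andbT ?ge0 ?le1//.
rewrite andbT lt_neqAle ge0 andbT; apply/eqP => r0.
by move/asboolPn: rQ; rewrite -r0; apply; exact: rational0.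
Qed.

Definition iotaG (r : {i01 R}) : Gamma R := MkGamma (iota_subproof r).

End Gamma.
Arguments gbot {R}.
Arguments gtop {R}.

Section GammaTheory.
Variable R : realType.
Implicit Types (x y z : Gamma R) (u v : gsymbol R) (r s : R).

Lemma rationalB r s : rational r -> rational s -> rational (r - s).
Proof. by move=> [p _ <-] [q _ <-]; exists (p - q) => //; rewrite rmorphB. Qed.

Lemma ltGE x y : (x < y)%O = gsym_lt (gsym x) (gsym y).
Proof. by []. Qed.

Lemma gsym_ltE u v : (u < v)%O = gsym_lt u v.
Proof. by []. Qed.

Lemma leGE x y : (x <= y)%O = (gsym x <= gsym y)%O.
Proof. by []. Qed.

Lemma gsym_lt_val u v : gsym_val u < gsym_val v -> (u < v)%O.
Proof. by case: u => r; case: v => s //=; exact: ltW. Qed.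

Lemma gsym_le_val u v : (u <= v)%O -> gsym_val u <= gsym_val v.
Proof.
by move=> uv; rewrite leNgt; apply/negP => /gsym_lt_val; rewrite ltNge uv.
Qed.

Lemma gbot_le x : (gbot <= x)%O.
Proof.
rewrite le_eqVlt ltGE; case: x => -[r|r] rv; have := rv; rewrite /=.
  by case/andP=> r0 _; rewrite r0 orbT.
case/andP=> /andP[+ _] _; rewrite le_eqVlt => /orP[/eqP r0|->]; last first.
  by rewrite orbT.
by apply/orP; left; apply/eqP/val_inj; rewrite /= r0.
Qed.

Lemma gsym_val_of r : gsym_val (gsym_of r) = r.
Proof. by rewrite /gsym_of; case: ifP. Qed.

Lemma gsym_val_sub u v : gsym_val (gsym_sub u v) = gsym_val u - gsym_val v.
Proof. by case: u; case: v => //= *; rewrite gsym_val_of. Qed.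

Lemma gvalid_of r : 0 <= r <= 1 -> gvalid (gsym_of r).
Proof.
move=> /andP[r0 r1]; exact: (gsymP (iotaG (Itv01 r0 r1))).
Qed.

Lemma gsub_valid x y : (y <= x)%O -> gvalid (gsym_sub x y).
Proof.
rewrite leGE => yx; have := gsym_le_val yx.
move: (gsymP x) (gsymP y) yx; case: (gsym x) => r; case: (gsym y) => s /=.
- by move=> ? ? _ ?; apply: gvalid_of; lra.
- by move=> ? /andP[? _]; rewrite le_eqVlt gsym_ltE /= => /orP[/eqP//|? _]; lra.
- by move=> /andP[? _] ? _ ?; apply: gvalid_of; lra.
- move=> /andP[? /asboolP rQ] /andP[? /asboolP sQ] _ ?.
  by apply/andP; split; [lra|apply/asboolP; exact: rationalB].
Qed.

Lemma gsubE x y : (y <= x)%O -> gsym (gsub x y) = gsym_sub x y.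
Proof. by move=> yx; apply: insubdK; exact: gsub_valid. Qed.

Lemma gsub_val x y : (y <= x)%O ->
  gsym_val (gsub x y) = gsym_val x - gsym_val y.
Proof. by move=> yx; rewrite gsubE // gsym_val_sub. Qed.

Lemma supremum_unique (A : set (Gamma R)) z :
  A !=set0 -> supremums A z -> supremum gbot A = z.
Proof.
move=> /set0P/negPf A0 Az; rewrite /supremum A0.
by apply: (is_subset1_supremums (A := A)) => //; apply: xgetPex; exists z.
Qed.

Lemma gsim_supremums_val x y : (y <= x)%O ->
  supremums [set gsub x z | z in gcirc_between y x] (gsim x y) /\
  gsym_val (gsim x y) = gsym_val x - gsym_val y.
Proof.
have [-> _|xy] := eqVneq y x; last rewrite le_eqVlt (negPf xy) /= => yx.
  have A0 : [set gsub x z | z in gcirc_between x x] = set0.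
    rewrite -subset0 => a [z [_ /andP[xz zx]] _].
    by have := lt_le_trans xz zx; rewrite ltxx.
  rewrite /gsim A0 supremum0 subrr; split=> //; split=> // z _.
  exact: gbot_le.
suff [w [Aw supw wE]] : exists w,
    [/\ [set gsub x z | z in gcirc_between y x] !=set0,
        supremums [set gsub x z | z in gcirc_between y x] w &
        gsym_val w = gsym_val x - gsym_val y].
  by rewrite /gsim (supremum_unique Aw supw).
have xv0 := gamma_ge0 x; have xv1 := gamma_le1 x.
have yv0 := gamma_ge0 y; have yv1 := gamma_le1 y.
have [[s ys sQ]|ynQ] := pselect (exists2 s, gsym y = Minus s & rational s).
  have sv : gvalid (Circ s).
    by have := gsymP y; rewrite ys /= => ?; apply/andP; split;
      [lra|exact/asboolP].
  pose c := MkGamma sv.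
  have cx : (c <= x)%O.
    move: yx; rewrite le_eqVlt !ltGE ys /=; case E : (gsym x) => [r|r] /=.
      by move=> ->; rewrite orbT.
    rewrite le_eqVlt => /orP[/eqP sr|->]; last by rewrite orbT.
    by apply/orP; left; apply/eqP/val_inj; rewrite /= E sr.
  have yc : (y < c)%O by rewrite ltGE ys /=.
  have Ac : [set gsub x z | z in gcirc_between y x] (gsub x c).
    by exists c => //; split; [exists s | rewrite yc].
  exists (gsub x c); split; first by exists (gsub x c).
    split; last by move=> b; apply.
    move=> _ [z [[q zq] /andP[yz zx]] <-]; have zQ := yz.
    move: zQ; rewrite ltGE ys zq /= => sq.
    have : (gsym_sub x z <= gsym_sub x c)%O.
      rewrite zq /= le_eqVlt; have [->|sq'] := eqVneq s q; first by rewrite eqxx.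
      rewrite gsym_lt_val ?orbT // !gsym_val_sub /=.
      by rewrite ltrD2l ltrN2 lt_neqAle sq' sq.
    by rewrite -!gsubE.
  by rewrite gsub_val // ys.
have ltyq q : rational q -> (y < Circ q :> gsymbol R)%O -> gsym_val y < q.
  rewrite gsym_ltE; case E : (gsym y) => [s|s] //= qQ.
  rewrite le_eqVlt => /orP[/eqP sq|//].
  by exfalso; apply: ynQ; exists s => //; rewrite sq.
have yxv : gsym_val y < gsym_val x.
  move: (yx); rewrite ltGE; case Ex : (gsym x) (gsymP x) => [r|r] rv.
    by case E : (gsym y) => [s|s].
  by move=> yr; apply: ltyq => //; case/andP: rv => _ /asboolP.
have wv : gvalid (Minus (gsym_val x - gsym_val y)) by rewrite /=; lra.
have dens t : gsym_val y < t -> t <= gsym_val x -> exists z,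
    [/\ gcirc_between y x z, gsym_val z < t & (z <= x)%O].
  move=> yt tx; have [q /itvP qE] := rat_in_itvoo yt.
  have qv : gvalid (Circ (ratr q : R)).
    apply/andP; split; last by apply/asboolP; exists q.
    by apply/andP; split; apply: ltW; [apply: le_lt_trans yv0 _|
      apply: lt_le_trans (le_trans tx xv1)]; rewrite qE.
  have zx : (MkGamma qv < x)%O.
    by apply: gsym_lt_val; rewrite /= (lt_le_trans _ tx) // qE.
  exists (MkGamma qv); split; [|by rewrite /= qE|exact: ltW].
  split; first by exists (ratr q).
  by rewrite (ltW zx) andbT; apply: gsym_lt_val; rewrite /= qE.
exists (MkGamma wv); split => //.
  by have [z [Az _ _]] := dens _ yxv (lexx _); exists (gsub x z), z.
split.
  move=> _ [z [[q zq] /andP[yz zx]] <-]; apply/ltW/gsym_lt_val.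
  rewrite /= gsub_val // ltrD2l ltrN2 zq /=; apply: ltyq.
    by have := gsymP z; rewrite zq => /andP[_ /asboolP].
  by move: yz; rewrite ltGE zq.
move=> b bub; rewrite leNgt; apply/negP => bw.
have bv : gsym_val b < gsym_val x - gsym_val y.
  by move: bw; rewrite ltGE /=; case: (gsym b).
have [||z [Az zt zx]] := dens (gsym_val x - gsym_val b).
- by rewrite ltrBrDr addrC -ltrBrDr.
- by rewrite gerBl gamma_ge0.
have := bub (gsub x z); move=> /(_ (ex_intro2 _ _ z Az erefl)).
apply/negP; rewrite -ltNge; apply: gsym_lt_val; rewrite gsub_val //.
by rewrite ltrBrDr addrC -ltrBrDr.
Qed.

Lemma gsim_supremums x y : (y <= x)%O ->
  supremums [set gsub x z | z in gcirc_between y x] (gsim x y).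
Proof. by case/gsim_supremums_val. Qed.

Lemma gsim_val x y : (y <= x)%O ->
  gsym_val (gsim x y) = gsym_val x - gsym_val y.
Proof. by case/gsim_supremums_val. Qed.

Lemma le_gammaG : {homo @gammaG R : x y / (x <= y)%O}.
Proof. by move=> x y xy; apply: (@gsym_le_val (gsym x) (gsym y)). Qed.

Lemma gsym_le_of u r : gvalid u -> gsym_val u <= r -> (u <= gsym_of r)%O.
Proof.
move=> uv; rewrite le_eqVlt => /orP[/eqP <-|ur]; last first.
  by apply/ltW/gsym_lt_val; rewrite gsym_val_of.
case: u uv => [s|s] /=; rewrite /gsym_of.
  by case: ifP => // _ _; apply: ltW; rewrite gsym_ltE /=.
by case/andP=> _ ->.
Qed.

Lemma gsub_iotaG (r s : {i01 R}) : s%:num <= r%:num ->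
  gsym (gsub (iotaG r) (iotaG s)) = gsym_of (r%:num - s%:num).
Proof.
move=> sr; have sr' : (iotaG s <= iotaG r)%O.
  by apply: gsym_le_of; rewrite ?iota_subproof ?gsym_val_of.
rewrite gsubE //= /gsym_of.
have [rQ|rQ] := asboolP (rational r%:num); have [sQ|sQ] := asboolP (rational s%:num) => //=.
- by rewrite ifT //; apply/asboolP; exact: rationalB.
- rewrite ifF //; apply/asboolP => rsQ; apply: rQ.
  case: rsQ sQ => p _ pE [q _ qE]; exists (p + q) => //.
  by rewrite rmorphD /= pE qE subrK.
Qed.

Lemma le_iotaG : {homo @iotaG R : r s / (r <= s)%O}.
Proof.
by move=> r s rs; apply: gsym_le_of; rewrite ?iota_subproof ?gsym_val_of.
Qed.

End GammaTheory.


HB.instance Definition _ (R : realType) :=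
  Topological.copy {i01 R} (initial_topology (fun x : {i01 R} => x%:num)).

(* X^down: the same points, with the open down-sets as open sets. *)
Definition downspace (d : Order.disp_t) (X : POrderedTopological.type d) : Type :=
  X.

Section DownSpace.
Context {d : Order.disp_t} {X : POrderedTopological.type d}.

Definition open_downset : set (set X) :=
  [set U | open U /\ forall x y : X, (y <= x)%O -> U x -> U y].

Fact open_downsetT : open_downset setT.
Proof. by split=> //; exact: openT. Qed.

Fact open_downsetI : setI_closed open_downset.
Proof.
move=> U V [oU dU] [oV dV]; split; first exact: openI.
by move=> x y yx [Ux Vx]; split; [exact: dU Ux | exact: dV Vx].
Qed.

Fact open_downset_bigcup (I : Type) (f : I -> set X) :
  (forall i, open_downset (f i)) -> open_downset (\bigcup_i f i).
Proof.
move=> fP; split; first by apply: bigcup_open => i _; case: (fP i).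
by move=> x y yx [i _ fx]; exists i => //; apply: (proj2 (fP i)) fx.
Qed.

HB.instance Definition _ := Choice.on (downspace X).
HB.instance Definition _ := isOpenTopological.Build (downspace X)
  open_downsetT open_downsetI open_downset_bigcup.

End DownSpace.

HB.instance Definition _ (I : Type) (d : Order.disp_t) (T : porderType d) :=
  Order.POrder.copy {ptws I -> T} (I -> T).

Section Measures.
Variables (R : realType) (d : Order.disp_t) (D : tbDistrLatticeType d).

Definition is_gamma_measure (mu : D -> Gamma R) : Prop :=
  [/\ {homo mu : a b / (a <= b)%O},
      mu \bot%O = gbot /\ mu \top%O = gtop &
      forall a b : D,
        (gsim (mu a) (mu (Order.meet a b))
           <= gsub (mu (Order.join a b)) (mu b))%O /\
        (gsim (mu (Order.join a b)) (mu b)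
           <= gsub (mu a) (mu (Order.meet a b)))%O].

Definition is_I_measure (m : D -> {i01 R}) : Prop :=
  [/\ {homo m : a b / (a <= b)%O},
      m \bot%O = 0%:i01 /\ m \top%O = 1%:i01 &
      forall a b : D, (m a)%:num + (m b)%:num =
        (m (Order.join a b))%:num + (m (Order.meet a b))%:num].

(* As subtypes of {ptws D -> _} these carry the subspace topology of the
   product topology; the order is the restriction of the pointwise one. *)
Definition MGamma : Type :=
  set_type [set mu : {ptws D -> Gamma R} | is_gamma_measure mu].
Definition MI : Type :=
  set_type [set m : {ptws D -> {i01 R}} | is_I_measure m].

HB.instance Definition _ := Topological.on MGamma.
HB.instance Definition _ := SubType.on MGamma.
HB.instance Definition _ :=
  [SubChoice_isSubPOrder of MGamma by <: with FunOrder.fun_display].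

HB.instance Definition _ := Topological.on MI.
HB.instance Definition _ := SubType.on MI.
HB.instance Definition _ :=
  [SubChoice_isSubPOrder of MI by <: with FunOrder.fun_display].

Fact gamma_sharp_subproof (mu : MGamma) :
  is_I_measure (fun a => gammaG (\val mu a)).
Proof.
case: mu => mu /= /set_mem[mono [mu0 mu1] muP]; split.
- by move=> a b ab; apply: le_gammaG; exact: mono.
- by rewrite mu0 mu1; split; exact/val_inj.
move=> a b; have [/gsym_le_val le1 /gsym_le_val le2] := muP a b.
have ma : (mu (Order.meet a b) <= mu a)%O by apply: mono; exact: leIl.
have mb : (mu b <= mu (Order.join a b))%O by apply: mono; exact: leUr.
move: le1 le2; rewrite !gsim_val // !gsub_val //=; lra.
Qed.

Fact iota_sharp_subproof (m : MI) :
  is_gamma_measure (fun a => iotaG (\val m a)).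
Proof.
case: m => m /= /set_mem[mono [m0 m1] mP]; split.
- by move=> a b ab; apply: le_iotaG; exact: mono.
- rewrite m0 m1; split; apply/val_inj; rewrite /= /gsym_of ifT //; apply/asboolP.
    exact: rational0.
  exact: rational1.
move=> a b; have mab := mP a b.
have ma : (m (Order.meet a b) <= m a)%O by apply: mono; exact: leIl.
have mb : (m b <= m (Order.join a b))%O by apply: mono; exact: leUr.
have ima := le_iotaG ma; have imb := le_iotaG mb.
split; rewrite leGE gsub_iotaG //; apply: gsym_le_of; rewrite ?gsymP //;
  rewrite gsim_val //= !gsym_val_of; lra.
Qed.

Definition gamma_sharp (mu : MGamma) : MI :=
  exist _ (fun a => gammaG (\val mu a)) (mem_set (gamma_sharp_subproof mu)).

Definition iota_sharp (m : MI) : MGamma :=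
  exist _ (fun a => iotaG (\val m a)) (mem_set (iota_sharp_subproof m)).

End Measures.

(* Main.v *)
(** A point x of Gamma is determined by its rational cut {q | q° <= x}, and
    every down-closed set of rationals in [0, 1] containing 0 arises this way. Since q^- is the
    predecessor of q°, the condition "q° <= x" is clopen, and these conditions
    generate the topology. The inequality x ~ y <= z - w translates into
    implications between such conditions, so each ultrafilter on the
    space of Gamma-valued measures converges, cut by cut, to a measure: the
    space is compact.

    Continuity of gamma^# holds already for the full topologies, and gamma^# is
    monotone. For iota^#, let U be an open down-set containing iota m, and
    suppose that measures m' arbitrarily close to m have iota m' outside U. By
    compactness the measures iota m' cluster at some mu outside U. If
    q° <= mu a then q <= m a, since otherwise m' a < q for all m' near m; hence
    mu <= iota m, and so mu lies in U, a contradiction. *)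

Require Import Defs.
From mathcomp Require Import all_boot all_order all_algebra.
From mathcomp Require Import all_classical all_reals topology normedtype.
From mathcomp Require Import finmap interval_inference lra.

Set Implicit Arguments.
Unset Strict Implicit.
Unset Printing Implicit Defensive.

Import Order.TTheory GRing.Theory Num.Theory.
Import numFieldNormedType.Exports.

Local Open Scope classical_set_scope.
Local Open Scope ring_scope.

(** * Rational cuts of points of [Gamma], and both differences in terms of cuts *)

Section Cuts.
Variable R : realType.
Implicit Types (x y z w : Gamma R) (u v : gsymbol R) (p q r s t : R).

Lemma rationalD r s : rational r -> rational s -> rational (r + s).
Proof. by move=> [p _ <-] [q _ <-]; exists (p + q) => //; rewrite rmorphD. Qed.

Lemma rat_between r s : r < s -> exists2 q, rational q & r < q < s.
Proof.
move=> /rat_in_itvoo[q]; rewrite in_itv /= => qE.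
by exists (ratr q) => //; exists q.
Qed.

Lemma le_Circ q u :
  (Circ q <= u)%O = match u with Minus r => q < r | Circ r => q <= r end.
Proof.
rewrite le_eqVlt gsym_ltE; case: u => r /=; first by case: eqP.
by rewrite le_eqVlt; congr orb; apply/eqP/eqP => [[->]|->].
Qed.

Lemma Circ_le1 x q : (Circ q <= gsym x)%O -> q <= 1.
Proof. by move=> /gsym_le_val qx; exact: le_trans qx (gamma_le1 x). Qed.

Lemma Circ_le0 x q : q <= 0 -> (Circ q <= gsym x)%O.
Proof.
move=> q0; have := gbot_le x; rewrite leGE; apply: le_trans.
by rewrite le_Circ.
Qed.

(** The point sits at the supremum of the rational members of [S]: it is [Circ] if the supremum is
    itself such a member, and [Minus] otherwise. *)
Lemma gamma_of_cut (S : set R) : S 0 -> (forall q, S q -> q <= 1) ->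
    (forall p q, p <= q -> S q -> S p) ->
  exists x, forall q, rational q -> (Circ q <= gsym x)%O <-> S q.
Proof.
move=> S0 S1 Sle.
pose T := S `&` [set q | rational q].
have T0 : T 0 by split => //; exact: rational0.
have supT : has_sup T by split; [exists 0|exists 1 => q [/S1]].
have s0 : 0 <= sup T by apply: sup_upper_bound.
have s1 : sup T <= 1 by apply: ge_sup; [exists 0|move=> q [/S1]].
have [Ts|nTs] := pselect (T (sup T)).
  have v : gvalid (Circ (sup T)).
    by rewrite /= s0 s1; apply/asboolP; case: Ts.
  exists (MkGamma v) => q qQ; rewrite le_Circ; split=> [qs|Sq].
    by apply: Sle qs _; case: Ts.
  by apply: sup_upper_bound.
have v : gvalid (Minus (sup T)).
  rewrite /= s1 andbT lt_neqAle s0 andbT; apply/eqP => E.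
  by apply: nTs; rewrite -E.
exists (MkGamma v) => q qQ; rewrite le_Circ; split=> [qs|Sq].
  have [r [Sr _] qr] := sup_gt (ex_intro _ _ T0) qs.
  by apply: Sle (ltW qr) Sr.
rewrite /= lt_neqAle; apply/andP; split; last exact: sup_upper_bound.
by apply/eqP => E; apply: nTs; rewrite -E.
Qed.

(** If y < x, a rational q with y < q° <= x separates them: r itself when x is r°, and a rational
    strictly between the two values when x is r^-. *)
Lemma le_cut x y : (x <= y)%O <->
  forall q, rational q -> (Circ q <= gsym x)%O -> (Circ q <= gsym y)%O.
Proof.
split=> [xy q _ qx|H]; first by apply: le_trans qx _; rewrite -leGE.
rewrite leNgt; apply/negP; rewrite ltGE.
have : forall q, rational q -> (gsym y < Circ q)%O -> ~~ (Circ q <= gsym x)%O.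
  by move=> q qQ yq; apply: contraTN yq => /(H _ qQ); rewrite -leNgt.
case: (gsym y) => s; case: (gsym x) (gsymP x) => r rv {}H /= sr.
- have [q qQ /andP[sq qr]] := rat_between sr.
  by have := H _ qQ; rewrite gsym_ltE le_Circ /= (ltW sq) qr => /(_ isT).
- have rQ : rational r by case/andP: rv => _ /asboolP.
  by have := H _ rQ; rewrite gsym_ltE le_Circ /= sr lexx => /(_ isT).
- have [q qQ /andP[sq qr]] := rat_between sr.
  by have := H _ qQ; rewrite gsym_ltE le_Circ /= sq qr => /(_ isT).
- have rQ : rational r by case/andP: rv => _ /asboolP.
  by have := H _ rQ; rewrite gsym_ltE le_Circ /= sr lexx => /(_ isT).
Qed.

Lemma le_Circ_of p r : rational p -> (Circ p <= gsym_of r)%O = (p <= r).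
Proof.
move=> pQ; rewrite /gsym_of; case: asboolP => rQ; rewrite le_Circ //.
by rewrite lt_neqAle; case: eqVneq => //= pr; case: rQ; rewrite -pr.
Qed.

(** Subtraction as residual of addition. For w = s° the choice t = s suffices; for w = s^- the
    rationals t < s come arbitrarily close to s. *)
Lemma gsub_ge_cut z w p : (w <= z)%O -> rational p ->
  (Circ p <= gsym (gsub z w))%O <->
  forall t, rational t -> (Circ t <= gsym w)%O -> (Circ (p + t) <= gsym z)%O.
Proof.
move=> wz pQ; rewrite gsubE // /gsym_sub.
case: (gsym w) (gsymP w) => s sv; last first.
  have sQ : rational s by case/andP: sv => _ /asboolP.
  case: (gsym z) => r; rewrite le_Circ; split=> [prs t tQ|/(_ _ sQ)];
    rewrite !le_Circ ?lexx; [lra|by move=> /(_ isT); lra|lra|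
      by move=> /(_ isT); lra].
case: (gsym z) => r; rewrite le_Circ_of //; split=> [prs t tQ|H];
  rewrite ?le_Circ; try lra.
all: rewrite leNgt; apply/negP => rsp.
all: have /rat_between[t tQ /andP[rt ts]] : r - p < s by lra.
all: by have := H _ tQ; rewrite !le_Circ ts => /(_ isT); lra.
Qed.

(* For [p = 0] the equivalence fails: [x ~ x = 0°] is an empty join. *)
Lemma gsim_ge_cut x y p : (y <= x)%O -> rational p -> 0 < p ->
  (Circ p <= gsym (gsim x y))%O <->
  exists q, [/\ rational q, ~ (Circ q <= gsym y)%O &
                (Circ (p + q) <= gsym x)%O].
Proof.
move=> yx pQ p0; have [ub lub] := gsim_supremums yx; split=> [psim|].
  apply: contrapT => nex.
  have p1 := Circ_le1 psim.
  (* [p^-] is the predecessor of [p°], so it would bound the whole join. *)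
  have v : gvalid (Minus p) by rewrite /= p0 p1.
  have : (gsim x y <= MkGamma v)%O.
    apply: lub => _ [z [[q zq] /andP[yz zx]] <-].
    have qQ : rational q by have := gsymP z; rewrite zq => /andP[_ /asboolP].
    have : ~ (Circ p <= gsym (gsub x z))%O.
      move=> /(gsub_ge_cut zx pQ)/(_ _ qQ); rewrite zq lexx => /(_ isT) pq.
      apply: nex; exists q; split => //.
      by move: yz; rewrite ltNge leGE zq => /negP.
    move/negP; rewrite -ltNge leGE gsym_ltE /=.
    case: (gsym (gsub x z)) => r /= rp; last exact: ltW.
    by move: rp; rewrite le_eqVlt => /predU1P[-> //|rp']; exact: ltW.
  by rewrite leGE => /(le_trans psim); rewrite le_Circ /= ltxx.
move=> [q [qQ /negP yq pqx]].
have pq1 := Circ_le1 pqx.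
have q0 : 0 < q by rewrite ltNge; apply: contraNN yq => /Circ_le0.
(* Here q° is a point with y < q° <= x, so x - q° is one of the elements of the join and already
   lies above p°. *)
have v : gvalid (Circ q).
  by apply/andP; split; [lra|exact/asboolP].
have zx : (MkGamma v <= x)%O.
  by rewrite leGE; apply: le_trans pqx; rewrite le_Circ; lra.
apply: (@le_trans _ _ (gsym (gsub x (MkGamma v)))).
  apply/(gsub_ge_cut zx pQ) => t tQ; rewrite le_Circ /= => tq.
  by apply: le_trans pqx; rewrite le_Circ; lra.
rewrite -leGE; apply: ub; exists (MkGamma v) => //; split; first by exists q.
by rewrite zx andbT ltNge.
Qed.

(** For each fixed p, q, t this involves only three cut conditions and implies a fourth, a form that
    survives limits along an ultrafilter. Nothing is lost by 0 < p, since p° lies below every point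
    otherwise. *)
Lemma gsim_le_gsub_cut x y z w : (y <= x)%O -> (w <= z)%O ->
  (gsim x y <= gsub z w)%O <->
  forall p q t, rational p -> rational q -> rational t -> 0 < p ->
    ~ (Circ q <= gsym y)%O -> (Circ (p + q) <= gsym x)%O ->
    (Circ t <= gsym w)%O -> (Circ (p + t) <= gsym z)%O.
Proof.
move=> yx wz; split=> [/le_cut sim_le p q t pQ qQ tQ p0 yq pqx|H].
  apply: (gsub_ge_cut wz pQ).1 => //; apply: sim_le => //.
  by apply/(gsim_ge_cut yx pQ p0); exists q.
apply/le_cut => p pQ; have [p0 _|p0] := leP p 0; first exact: Circ_le0.
move=> /(gsim_ge_cut yx pQ p0)[q [qQ yq pqx]].
by apply/(gsub_ge_cut wz pQ) => t tQ; apply: (H p q).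
Qed.

End Cuts.

(** * Convergence in initial and product topologies; continuity for open down-sets *)

Lemma cvg_initial (S : choiceType) (T : topologicalType) (f : S -> T)
    (F : set_system S) (s : initial_topology f) : Filter F ->
  F --> s <-> f @ F --> f s.
Proof.
move=> FF; split=> [Fs|fFs A].
  exact: (cvg_trans (cvg_app f Fs) (@initial_continuous S T f s)).
rewrite nbhsE => -[_ [[B oB <-] Bfs] sBA].
by apply: (filterS sBA); apply: fFs; exact: open_nbhs_nbhs.
Qed.

Lemma cvg_ptws (I : Type) (T : topologicalType) (F : set_system {ptws I -> T})
    (f : {ptws I -> T}) : Filter F ->
  F --> f <-> forall i, g i @[g --> F] --> f i.
Proof.
move=> FF; rewrite cvg_sup.
by split=> Ff i; apply/cvg_initial; exact: Ff.
Qed.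

Lemma cvg_set_ptws (I : Type) (T : topologicalType) (P : set {ptws I -> T})
    (F : set_system P) (f : P) : Filter F ->
  F --> f <-> forall i, \val g i @[g --> F] --> \val f i.
Proof. by move=> FF; rewrite cvg_initial cvg_ptws. Qed.

Lemma downspace_continuous d1 d2 (X : POrderedTopological.type d1)
    (Y : POrderedTopological.type d2) (f : X -> Y) :
  continuous f -> {homo f : x y / (x <= y)%O} ->
  continuous (f : downspace X -> downspace Y).
Proof.
move=> /continuousP fC fM; apply/continuousP => A [oA dA].
split; first exact: fC.
by move=> x y yx; apply: dA; exact: fM.
Qed.

(** * Convergence in [Gamma] tested on cuts, and continuity of [gammaG] *)

Section GammaTopology.
Variable R : realType.
Implicit Types (x y : Gamma R) (F : set_system (Gamma R)) (q : R).

Lemma cvg_Gamma F x : Filter F ->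
  F --> x <-> forall B, gsubbase B -> B x -> F B.
Proof.
move=> FF; split=> [Fx B gB Bx|FB A].
  apply: Fx; exists B; split=> //; exists [set B]; last first.
    by rewrite predeqE => ?; split=> [[_ ->]|] //; exists B.
  move=> _ ->; exists [fset B]%fset.
    by move=> E /fset1P ->; exact: mem_set.
  apply/seteqP; split=> y /=; first by apply; exact/fset1P.
  by move=> By E /fset1P ->.
rewrite nbhsE => -[_ [[B sB <-] [C BC Cx] sUBA]].
apply: filterS sUBA _; apply: (@filterS _ _ _ C); first by move=> ? ?; exists C.
have /sB [D sD IDeC] := BC; rewrite -IDeC; apply: filter_bigI => E DE.
have /sD/set_mem gE := DE.
by apply: FB => //; move: Cx; rewrite -IDeC => /(_ _ DE).
Qed.

(** Since q^- is the immediate predecessor of q°, the two kinds of subbasic sets are complements of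
    each other. *)
Lemma le_Minus q x : (gsym x <= Minus q)%O = ~~ (Circ q <= gsym x)%O.
Proof.
rewrite le_Circ; case: (gsym x) => r /=; last first.
  by rewrite -ltNge le_eqVlt gsym_ltE; case: eqP.
rewrite -leNgt le_eqVlt gsym_ltE /= le_eqVlt.
by congr orb; apply/eqP/eqP => [[->]|->].
Qed.

Lemma cvg_Gamma_cut F x : ProperFilter F ->
  F --> x <-> forall q, rational q ->
    if (Circ q <= gsym x)%O then F [set y | (Circ q <= gsym y)%O]
    else F [set y | ~~ (Circ q <= gsym y)%O].
Proof.
move=> FF; rewrite cvg_Gamma; split=> [FB q qQ|Fq B].
  (* For q <= 0 the cut condition always holds and for q > 1 it never does; only the remaining q
     correspond to subbasic sets. *)
  have [q0|q0] := leP q 0.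
    by rewrite Circ_le0 //; apply: nearW => y; exact: Circ_le0.
  have [q1|q1] := leP q 1; last first.
    have nq y : ~~ (Circ q <= gsym y)%O.
      by apply: contraTN q1 => /Circ_le1; rewrite leNgt.
    by rewrite (negPf (nq x)); exact: nearW.
  case: ifPn => qx; apply: FB => //.
    by left; exists q => //; split => //; rewrite (ltW q0) q1.
  by right; exists q; [split=> //; rewrite q0 q1|
    apply/seteqP; split => y /=; rewrite le_Minus].
case=> -[q [qQ _] <-] /= qx; have := Fq _ qQ.
  by rewrite qx.
rewrite le_Minus in qx; rewrite (negPf qx).
by apply: filterS => y /=; rewrite le_Minus.
Qed.

Lemma gsym_val_continuous : continuous (fun x : Gamma R => gsym_val (gsym x)).
Proof.
move=> x; have cx := (@cvg_Gamma_cut (nbhs x) x (nbhs_pfilter x)).1 cvg_id.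
apply: (@cvgrPdist_lt _ _ _ (nbhs x) (nbhs_filter x) _ _).2 => e e0.
have [a aQ /andP[a1 a2]] : exists2 a, rational a &
    gsym_val (gsym x) - e < a < gsym_val (gsym x).
  by apply: rat_between; lra.
have [b bQ /andP[b1 b2]] : exists2 b, rational b &
    gsym_val (gsym x) < b < gsym_val (gsym x) + e.
  by apply: rat_between; lra.
have := cx _ aQ; rewrite ltW ?gsym_lt_val // => na.
have := cx _ bQ; rewrite leNgt gsym_lt_val //= => nb.
near=> y.
have /gsym_le_val/= ay : (Circ a <= gsym y)%O by near: y.
have /ltW/gsym_le_val/= yb : (gsym y < Circ b)%O.
  by rewrite ltNge; near: y.
by rewrite ltr_norml; lra.
Unshelve. all: by end_near. Qed.

Lemma gammaG_continuous : continuous (@gammaG R).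
Proof.
move=> x; have xF := nbhs_filter x; apply/cvg_initial.
exact: (@gsym_val_continuous x).
Qed.

End GammaTopology.

(** * Compactness of the space of [Gamma]-valued measures, and continuity of both maps *)

Section MeasureSpaces.
Variables (R : realType) (d : Order.disp_t) (D : tbDistrLatticeType d).
Notation MG := (MGamma R D).

Lemma gamma_sharp_homo :
  {homo @gamma_sharp R d D : mu nu / (mu <= nu)%O}.
Proof.
by move=> mu nu /lefP mn; apply/lefP => a; apply: le_gammaG; exact: mn.
Qed.

Lemma iota_sharp_homo : {homo @iota_sharp R d D : m n / (m <= n)%O}.
Proof.
by move=> m n /lefP mn; apply/lefP => a; apply: le_iotaG; exact: mn.
Qed.

Lemma gamma_sharp_continuous : continuous (@gamma_sharp R d D).
Proof.
move=> mu; have muF := nbhs_filter mu; apply/cvg_set_ptws => a.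
have /(_ a) mua := (cvg_set_ptws mu (nbhs_filter mu)).1 cvg_id.
exact: (cvg_comp _ _ mua (@gammaG_continuous R _)).
Qed.

Lemma MGamma_ultra_cvg (F : set_system MG) : UltraFilter F ->
  exists mu : MG, F --> mu.
Proof.
move=> FU.
(* The limit at a is the point whose cut consists of the q with q° <= mu a for [F]-almost all mu. *)
pose cutP a x := forall q, rational q ->
  (Circ q <= gsym x)%O <-> F [set mu : MG | (Circ q <= gsym (\val mu a))%O].
have /choice[g gP] : forall a, exists x, cutP a x.
  move=> a; apply: gamma_of_cut => [|q|p q pq].
  - by apply: nearW => mu; exact: Circ_le0.
  - by move=> /filter_ex[mu /Circ_le1].
  - by apply: filterS => mu; apply: le_trans; rewrite le_Circ.
(* Negated cut conditions also pass from the limit to [F], because [F] is an ultrafilter; the [~]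
   premise of [gsim_le_gsub_cut] requires this. *)
have gPn a q : rational q -> ~ (Circ q <= gsym (g a))%O ->
    F [set mu | ~ (Circ q <= gsym (\val mu a))%O].
  move=> qQ /(gP _ _ qQ) nF.
  pose A := [set mu : MG | (Circ q <= gsym (\val mu a))%O].
  by case: (in_ultra_setVsetC A FU).
have MP (mu : MG) : is_gamma_measure (\val mu) by case: mu => mu /= /set_mem.
have gM : {homo g : a b / (a <= b)%O}.
  move=> a b ab; apply/le_cut => q qQ /(gP _ _ qQ) Fq; apply/(gP _ _ qQ).
  apply: filterS Fq => mu /= qa; apply: le_trans qa _.
  by case: (MP mu) => + _ _; apply.
have gconst a x : (forall mu : MG, \val mu a = x) -> g a = x.
  move=> ax; apply: le_anti; apply/andP; split; apply/le_cut => q qQ.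
    by move=> /(gP _ _ qQ)/filter_ex[mu]; rewrite -(ax mu).
  by move=> qx; apply/(gP _ _ qQ)/nearW => mu; rewrite -(ax mu) in qx.
have gsimM a b c e : (b <= a)%O -> (e <= c)%O ->
    (forall mu : MG, (gsim (\val mu a) (\val mu b)
                       <= gsub (\val mu c) (\val mu e))%O) ->
    (gsim (g a) (g b) <= gsub (g c) (g e))%O.
  move=> ba ec simM; apply/gsim_le_gsub_cut; rewrite ?gM //.
  move=> p q t pQ qQ tQ p0 /(gPn _ _ qQ) Fq.
  move=> /(gP _ _ (rationalD pQ qQ)) Fpq /(gP _ _ tQ) Ft.
  apply/(gP _ _ (rationalD pQ tQ)).
  apply: filterS (filterI Fq (filterI Fpq Ft)) => mu [muq [mupq mut]] /=.
  have [muM _ _] := MP mu.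
  have /(gsim_le_gsub_cut (muM _ _ ba) (muM _ _ ec))/(_ p q t) := simM mu.
  exact.
have gmeas : is_gamma_measure g.
  split=> //.
    by split; apply: gconst => mu; case: (MP mu) => _ [].
  move=> a b; split; apply: gsimM; rewrite ?leIl ?leUr // => mu;
    by case: (MP mu) => _ _ /(_ a b)[].
exists (exist _ (g : {ptws D -> Gamma R}) (mem_set gmeas)).
apply/cvg_set_ptws => a; apply/cvg_Gamma_cut => q qQ.
case: ifPn => [/(gP _ _ qQ)//|/negP/(gPn _ _ qQ) Fn].
by apply: (@filterS _ F _ _ _ _ Fn) => mu /negP.
Qed.

Lemma MGamma_compact : compact [set: MG].
Proof.
by rewrite compact_ultra => F /MGamma_ultra_cvg[mu Fmu] _; exists mu.
Qed.

Lemma MI_eval_lt (m : MI R D) a q : (\val m a)%:num < q ->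
  \forall m' \near m, (\val m' a)%:num < q.
Proof.
move=> maq.
have ma := (cvg_set_ptws m (nbhs_filter m)).1 cvg_id a.
have maF : Filter (\val g a @[g --> nbhs m]) := fmap_filter _ (nbhs_filter m).
by have /cvg_initial/(_ _ (lt_nbhsl maq)) := ma.
Qed.

Lemma MGamma_near_cut (mu : MG) a q : rational q ->
  (Circ q <= gsym (\val mu a))%O ->
  \forall nu \near mu, (Circ q <= gsym (\val nu a))%O.
Proof.
move=> qQ qmu.
have mua := (cvg_set_ptws mu (nbhs_filter mu)).1 cvg_id a.
have muF := fmap_proper_filter (fun g : MG => \val g a) (nbhs_pfilter mu).
by have := (cvg_Gamma_cut _ muF).1 mua _ qQ; rewrite qmu.
Qed.

Lemma iota_sharp_continuous :
  continuous (@iota_sharp R d D : downspace (MI R D) -> downspace MG).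
Proof.
apply/continuousP => U [oU dU]; split; last first.
  by move=> x y yx; apply: dU; exact: iota_sharp_homo.
rewrite openE => m Um; apply: contrapT => nU.
(* [F] is generated by the images of the points near m that [iota_sharp] sends outside [U]. It is
   proper because the preimage of [U] is assumed not to be a neighbourhood of m. *)
pose F :=
  iota_sharp x @[x --> within (~` (@iota_sharp R d D @^-1` U)) (nbhs m)].
have FF : ProperFilter F.
  apply: fmap_proper_filter; apply: Build_ProperFilter_ex => P mP.
  apply: contrapT => /forallNP nP; apply: nU.
  apply: (@filterS _ (nbhs m) (nbhs_filter m) _ _ _ mP) => x Px.
  by apply: contrapT => nUx; exact: (nP x (Px nUx)).
have [mu [_ Fmu]] := MGamma_compact FF filterT.
have FnU : F (~` U) by apply: withinT; exact: nbhs_filter.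
have nUmu : ~ U mu.
  by move=> Umu; have [nu []] := Fmu _ _ FnU (open_nbhs_nbhs (conj oU Umu)).
(* As [U] is a down-set containing iota m, it suffices that mu <= iota m. If q° <= mu a but m a < q,
   then nu a < q° on a member of [F], which misses the neighbourhood of mu given by q° <= nu a. *)
apply: nUmu; apply: dU Um; apply/lefP => a.
apply/le_cut => q qQ qmu; rewrite /= le_Circ_of // leNgt; apply/negP => maq.
have FU : F [set nu | ~~ (Circ q <= gsym (\val nu a))%O].
  apply: cvg_within; apply: filterS (MI_eval_lt maq) => m' m'q.
  by rewrite /= le_Circ_of // -ltNge.
by have [nu [/= /negP]] := Fmu _ _ FU (MGamma_near_cut qQ qmu).
Qed.

End MeasureSpaces.

Theorem theorem4p10 (R : realType) (d : Order.disp_t) (D : tbDistrLatticeType d) :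
  continuous (@gamma_sharp R d D : downspace (MGamma R D) -> downspace (MI R D)) /\
  continuous (@iota_sharp R d D : downspace (MI R D) -> downspace (MGamma R D)) /\
  (@gamma_sharp R d D) \o (@iota_sharp R d D) = id.
Proof.
split; last split.
- apply: downspace_continuous; first exact: gamma_sharp_continuous.
  exact: gamma_sharp_homo.
- exact: iota_sharp_continuous.
- apply/funext => m; apply/val_inj/funext => a; apply/val_inj.
  by rewrite /= gsym_val_of.
Qed.
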